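(* Let $\mu$ be a partition of $n$ and $\alpha$ a composition of $n$. The map $\mathcal{T}$ maps $\Pi(\mu',\alpha)$ onto $\mathrm{SYT}(\mu,\alpha)$; that is, $\mathcal{T}(\mathcal{A})\in\mathrm{SYT}(\mu,\alpha)$ for every $\mathcal{A}\in\Pi(\mu',\alpha)$, and every element of $\mathrm{SYT}(\mu,\alpha)$ is of this form.
   Context: For a composition $\alpha=(\alpha_1,\ldots,\alpha_k)$ of $n$ (positive integers with sum $n$), $\mathcal{A}_\alpha$ is the set partition of $[n]=\{1,\ldots,n\}$ with blocks $A_i=\{\alpha_1+\cdots+\alpha_{i-1}+1,\ldots,\alpha_1+\cdots+\alpha_i\}$. The shape of a set partition is the integer partition formed by its block sizes; $\mu'$ is the conjugate of $\mu$. $\Pi(\mu',\alpha)$ is the set of set partitions $\mathcal{A}$ of $[n]$ of shape $\mu'$ such that each block of $\mathcal{A}$ meets each block of $\mathcal{A}_\alpha$ in at most one element. For a set partition $\mathcal{A}$ of $[n]$ of shape $\mu'$, $\mathcal{T}(\mathcal{A})$ is the tableau of shape $\mu$ whose $i$-th row consists of the elements of $[n]$ that are the $i$-th smallest element of their block in $\mathcal{A}$, listed in increasing order. $\mathrm{SYT}(\mu,\alpha)$ is the set of standard tableaux $T$ of shape $\mu$ (entries $1,\ldots,n$ each once, rows and columns increasing) such that no column of $T$ contains more than one element of any block of $\mathcal{A}_\alpha$. *)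

(* Defs.v *)
From mathcomp Require Import all_boot.

Set Implicit Arguments.
Unset Strict Implicit.
Unset Printing Implicit Defensive.

(* The ground set [n] = {1, ..., n} is encoded as 'I_n = {0, ..., n - 1}, and
   rows, columns, parts and blocks are numbered from 0. *)

Definition is_part_of (n : nat) (mu : seq nat) : bool :=
  [&& sorted geq mu, 0 \notin mu & sumn mu == n].

Definition is_comp_of (n : nat) (alpha : seq nat) : bool :=
  (0 \notin alpha) && (sumn alpha == n).

Definition conj_part (mu : seq nat) : seq nat :=
  [seq count (fun m => j < m) mu | j <- iota 0 (head 0 mu)].

Section SetPartitions.

Variable n : nat.
Implicit Types (A : {set {set 'I_n}}) (nu alpha : seq nat).

Definition is_setpart A : bool := partition A [set: 'I_n].

Definition setpart_shape A : seq nat := sort geq [seq #|B : {set 'I_n}| | B in A].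

Definition comp_block alpha (i : nat) : {set 'I_n} :=
  [set x : 'I_n | sumn (take i alpha) <= x < sumn (take i.+1 alpha)].

Definition comp_setpart alpha : {set {set 'I_n}} :=
  [set comp_block alpha i | i : 'I_(size alpha)].

Definition Pi_set nu alpha : {set {set {set 'I_n}}} :=
  [set A : {set {set 'I_n}} |
    [&& is_setpart A, setpart_shape A == nu
      & [forall B in A, forall C in comp_setpart alpha, #|B :&: C| <= 1]]].

(* x is the (block_rank A x).+1-th smallest element of its block in A. *)
Definition block_rank A (x : 'I_n) : nat := #|[set y in pblock A x | y < x]|.

(* Tableaux are lists of rows. The enumeration of 'I_n is increasing, and
   \max_(B in A) #|B| is the number of values taken by block_rank A. *)
Definition tableau_of A : seq (seq 'I_n) :=
  [seq [seq x <- enum 'I_n | block_rank A x == i]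
     | i <- iota 0 (\max_(B in A) #|B|)].

End SetPartitions.

Section Tableaux.

Variable n : nat.
Implicit Types (T : seq (seq 'I_n)) (mu alpha : seq nat).

Definition increasing (s : seq 'I_n) : bool :=
  sorted (fun x y : 'I_n => x < y) s.

(* Rows too short to reach column j contribute nothing. *)
Definition column T (j : nat) : seq 'I_n := pmap (fun r => onth r j) T.

Definition columns T : seq (seq 'I_n) :=
  [seq column T j | j <- iota 0 (size (head [::] T))].

Definition is_std_tableau mu T : bool :=
  [&& [seq size r | r <- T] == mu,
      perm_eq (flatten T) (enum 'I_n),
      all increasing T
    & all increasing (columns T)].

Definition SYT mu alpha : pred (seq (seq 'I_n)) :=
  [pred T | is_std_tableau mu T &&
    all (fun c : seq 'I_n =>
           [forall C in comp_setpart n alpha, count [in C] c <= 1])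
        (columns T)].

End Tableaux.

Arguments Pi_set n nu alpha : clear implicits.
Arguments SYT n mu alpha : clear implicits.

(* Main.v *)
(* Let x lie above y in a column of T(A), in rows i < k. The entries of row k up
   to y are at least as many as the entries of row i up to x, and the map sending
   each of them to the i-th smallest element of its block is injective and
   decreases entries. So some block of A contains z < w with x <= z < w <= y.
   Hence columns increase; and since the blocks of A_alpha are intervals, if x and
   y lay in a common one it would contain z and w, against A in Pi(mu', alpha).
   Conversely, the columns of T in SYT(mu, alpha), read as sets, form a set
   partition in Pi(mu', alpha) whose tableau is T. *)
Require Import Defs.
From mathcomp Require Import all_boot.

Set Implicit Arguments.
Unset Strict Implicit.
Unset Printing Implicit Defensive.

(** * Conjugate partitions *)

(** Both sides say that the cell in row i and column j lies in the Young diagram of [mu]: as [mu]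
    decreases weakly, the rows longer than j form an initial segment. *)
Lemma ltn_count_gtn (mu : seq nat) i j :
  sorted geq mu -> (i < count (fun m => j < m) mu) = (j < nth 0 mu i).
Proof.
elim: mu i => [|m mu IH] i; first by rewrite nth_nil.
move=> mu_sorted; have /= := mu_sorted; rewrite path_sortedE; last first.
  by move=> ? ? ? ? /leq_trans; exact.
case/andP=> /allP le_m /IH {}IH; case: (ltnP j m) => [j_lt|m_le] /=.
  by case: i => [|i] //=; rewrite add1n ltnS IH.
have -> : count (fun m => j < m) mu = 0.
  apply/eqP; rewrite -leqn0 leqNgt -has_count; apply/hasPn => x /le_m le_xm.
  by rewrite -leqNgt (leq_trans le_xm).
rewrite ltn0; case: (ltnP i (size (m :: mu))) => [|ge_i]; last first.
  by rewrite nth_default.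
case: i => [|i] /= lt_i; first by rewrite ltnNge m_le.
apply/esym/negbTE; rewrite -leqNgt; apply: leq_trans m_le.
exact/le_m/mem_nth.
Qed.

Lemma count_ltn_iota a k : a <= k -> count (fun j => j < a) (iota 0 k) = a.
Proof.
move=> le_ak; rewrite -size_filter.
exact: etrans (congr1 size (filter_iota_ltn 0 le_ak)) (size_iota _ _).
Qed.

(** This is the involutivity of conjugation: column j has more than i cells exactly when j is less
    than the i-th part of [mu]. *)
Lemma count_conj_part mu i :
  sorted geq mu -> count (fun m => i < m) (conj_part mu) = nth 0 mu i.
Proof.
move=> mu_sorted; rewrite count_map.
rewrite (eq_count (a2 := fun j => j < nth 0 mu i)); last first.
  by move=> j /=; rewrite ltn_count_gtn.
rewrite count_ltn_iota //.
(* It remains to see that no part exceeds the first one, which bounds the column indices in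
   [conj_part]. *)
case: mu mu_sorted => [|m mu] /=; first by rewrite nth_nil.
rewrite path_sortedE; last by move=> ? ? ? ? /leq_trans; exact.
case: i => [|i] //= /andP[/allP le_m _].
case: (ltnP i (size mu)) => [lt_i|ge_i]; last by rewrite nth_default.
exact/le_m/mem_nth.
Qed.

Lemma sorted_conj_part mu : sorted geq (conj_part mu).
Proof.
rewrite sorted_map; apply: sub_sorted (iota_sorted 0 _) => i j /= le_ij.
by apply: sub_count => m /=; apply: leq_ltn_trans.
Qed.

Lemma card_set_count (T : finType) (B : {pred T}) (p : pred T) (s : seq T) :
  uniq s -> B =i s ->
  #|[set y in B | p y]| = count p s.
Proof.
move=> s_uniq eq_B; rewrite -size_filter -(card_uniqP _) ?filter_uniq //.
by apply: eq_card => y; rewrite inE mem_filter eq_B andbC.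
Qed.

(** * Increasing sequences in the ground set *)

Section IncreasingSequences.

Variable n : nat.
Implicit Types (x y : 'I_n) (s : seq 'I_n) (B : {set 'I_n}).

Lemma increasingE s : increasing s = pairwise (fun x y : 'I_n => x < y) s.
Proof. by apply: sorted_pairwise => ? ? ?; apply: ltn_trans. Qed.

Lemma increasing_uniq s : increasing s -> uniq s.
Proof.
apply: sorted_uniq; first by move=> ? ? ?; apply: ltn_trans.
by move=> x; apply: ltnn.
Qed.

Lemma increasing_ext s1 s2 :
  increasing s1 -> increasing s2 -> s1 =i s2 -> s1 = s2.
Proof.
apply: irr_sorted_eq; first by move=> ? ? ?; apply: ltn_trans.
by move=> x; apply: ltnn.
Qed.

Lemma increasing_filter_enum (p : pred 'I_n) :
  increasing [seq x <- enum 'I_n | p x].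
Proof.
apply: sorted_filter; first by move=> ? ? ?; apply: ltn_trans.
by have := iota_ltn_sorted 0 n; rewrite -val_enum_ord sorted_map.
Qed.

Lemma increasing_enum B : increasing (enum B).
Proof.
suff -> : enum B = [seq x <- enum 'I_n | x \in B].
  exact: increasing_filter_enum.
by rewrite enumT [LHS]/enum_mem.
Qed.

Lemma increasing_count_ltn x0 s i : increasing s -> i < size s ->
  count (fun y : 'I_n => y < nth x0 s i) s = i.
Proof.
rewrite increasingE.
elim: s i => [|x s IH] //= i /andP[/allP lt_x /IH {}IH] lt_i.
case: i lt_i => [|i] /= lt_i; last by rewrite lt_x ?mem_nth // IH.
rewrite ltnn; apply/eqP; rewrite -leqn0 leqNgt -has_count.
by apply/hasPn => y /lt_x lt_xy; rewrite -leqNgt ltnW.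
Qed.

Lemma increasing_count_leq x0 s i : increasing s -> i < size s ->
  count (fun y : 'I_n => y <= nth x0 s i) s = i.+1.
Proof.
rewrite increasingE.
elim: s i => [|x s IH] //= i /andP[/allP lt_x /IH {}IH] lt_i.
case: i lt_i => [|i] /= lt_i; last by rewrite ltnW ?lt_x ?mem_nth // IH.
rewrite leqnn; congr _.+1; apply/eqP; rewrite -leqn0 leqNgt -has_count.
by apply/hasPn => y /lt_x lt_xy; rewrite -ltnNge.
Qed.

Lemma count_le1_pairwise (p : pred 'I_n) s :
  pairwise (fun x y => ~~ (p x && p y)) s -> count p s <= 1.
Proof.
elim: s => //= x s IH /andP[/allP px /IH]; case: (boolP (p x)) => // x_p _.
rewrite add1n ltnS leqNgt -has_count; apply/hasPn => y /px.
by rewrite x_p.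
Qed.

End IncreasingSequences.

(** * Cells and columns of a list of rows *)

Section Columns.

Variable n : nat.
Implicit Types (x : 'I_n) (T : seq (seq 'I_n)).

Lemma size_column T j :
  size (column T j) = count (fun m => j < m) [seq size r | r <- T].
Proof. by rewrite size_pmap count_map; apply: eq_count => r /=; rewrite onthTE. Qed.

(** Row lengths decrease weakly, so once a row misses column j all later rows do. Hence [pmap] drops
    only a tail, and positions in the column are row numbers. *)
Lemma nth_column x0 T j i : sorted geq [seq size r | r <- T] ->
  i < size (column T j) -> nth x0 (column T j) i = nth x0 (nth [::] T i) j.
Proof.
elim: T i => [|r T IH] i //= T_sorted.
have {}IH := IH _ (path_sorted T_sorted).
case r_j: (onth r j) => [x|] /=; last first.
  move=> lt_i; have : 0 < size (column (r :: T) j) by rewrite /= r_j (leq_trans _ lt_i).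
  by rewrite size_column ltn_count_gtn //= -onthTE r_j.
by case: i => [|i] /= lt_i; [rewrite (onth_nth _ _ _ _ r_j) | exact: IH].
Qed.

(** In a duplicate-free list an entry determines its position in [flatten T], and [flatten_index]
    recovers the cell from that position. *)
Lemma uniq_flatten_nth x0 T i j i' j' : uniq (flatten T) ->
  j < size (nth [::] T i) -> j' < size (nth [::] T i') ->
  nth x0 (nth [::] T i) j = nth x0 (nth [::] T i') j' -> i = i' /\ j = j'.
Proof.
move=> T_uniq.
have nth_shape k : size (nth [::] T k) = nth 0 (shape T) k.
  case: (ltnP k (size T)) => lt_k; first by rewrite (nth_map [::]).
  by rewrite !nth_default ?size_map.
rewrite !nth_shape => lt_j lt_j'.
have nthE a b : b < nth 0 (shape T) a ->
    nth x0 (nth [::] T a) b = nth x0 (flatten T) (flatten_index (shape T) a b).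
  by move=> lt_b; rewrite nth_flatten flatten_indexKl // flatten_indexKr.
rewrite !nthE // => /eqP; rewrite nth_uniq ?size_flatten ?flatten_indexP //.
move=> /eqP eq_k; split.
  by rewrite -(flatten_indexKl lt_j) eq_k flatten_indexKl.
by rewrite -(flatten_indexKr lt_j) eq_k flatten_indexKr.
Qed.

End Columns.

(** * Ranks within blocks and the rows they define *)

Section SetPartitionTableau.

Variables (n : nat) (A : {set {set 'I_n}}).
Hypothesis A_part : is_setpart A.
Implicit Types (x y z w : 'I_n) (B C : {set 'I_n}).

Definition block_row i : seq 'I_n := [seq x <- enum 'I_n | block_rank A x == i].

Lemma setpart_pblock_mem x : pblock A x \in A.
Proof. by apply: pblock_mem; rewrite (cover_partition A_part) inE. Qed.

Lemma setpart_mem_pblock x : x \in pblock A x.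
Proof. by rewrite mem_pblock (cover_partition A_part) inE. Qed.

Lemma setpart_def_pblock B x : B \in A -> x \in B -> pblock A x = B.
Proof. by case/and3P: A_part => _ + _; apply: def_pblock. Qed.

Lemma block_rank_count x s : uniq s -> pblock A x =i s ->
  block_rank A x = count (fun y : 'I_n => y < x) s.
Proof. exact: card_set_count. Qed.

Lemma block_rankE x : block_rank A x = index x (enum (pblock A x)).
Proof.
have x_in : x \in enum (pblock A x) by rewrite mem_enum setpart_mem_pblock.
rewrite (@block_rank_count _ (enum (pblock A x))) ?enum_uniq //; last first.
  by move=> y; rewrite mem_enum.
rewrite -{1}(nth_index x x_in) increasing_count_ltn ?index_mem //.
exact: increasing_enum.
Qed.

Lemma nth_block x0 B i : B \in A -> i < #|B| ->
  pblock A (nth x0 (enum B) i) = B /\ block_rank A (nth x0 (enum B) i) = i.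
Proof.
move=> B_in lt_i; have pE : pblock A (nth x0 (enum B) i) = B.
  by apply: setpart_def_pblock; rewrite // -mem_enum mem_nth // -cardE.
by split=> //; rewrite block_rankE pE index_uniq ?enum_uniq // -cardE.
Qed.

Lemma block_rank_lt x : block_rank A x < #|pblock A x|.
Proof.
by rewrite block_rankE cardE index_mem mem_enum setpart_mem_pblock.
Qed.

Lemma block_rank_inj x y :
  pblock A x = pblock A y -> block_rank A x = block_rank A y -> x = y.
Proof.
move=> eq_p; rewrite !block_rankE -eq_p.
move/(congr1 (nth x (enum (pblock A x)))).
by rewrite !nth_index // mem_enum ?setpart_mem_pblock // eq_p setpart_mem_pblock.
Qed.

Lemma leq_block_rank x y : pblock A x = pblock A y -> x <= y ->
  block_rank A x <= block_rank A y.
Proof.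
move=> eq_p le_xy; apply: subset_leq_card; apply/subsetP=> z.
rewrite !inE eq_p => /andP[-> /= lt_zx]; exact: leq_trans lt_zx le_xy.
Qed.

Lemma increasing_block_row i : increasing (block_row i).
Proof. exact: increasing_filter_enum. Qed.

Lemma mem_block_row i x : (x \in block_row i) = (block_rank A x == i).
Proof. by rewrite mem_filter mem_enum andbT. Qed.

(** The map [pblock A] is a bijection from row i onto these blocks: a block and a rank determine an
    element, and each such block has an element of rank i. *)
Lemma size_block_row i : size (block_row i) = #|[set B in A | i < #|B| ]|.
Proof.
rewrite -(card_uniqP (increasing_uniq (increasing_block_row i))).
rewrite -(card_in_imset (f := pblock A)); last first.
  move=> x y; rewrite !mem_block_row => /eqP x_i /eqP y_i /block_rank_inj.
  by apply; rewrite x_i.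
apply: eq_card => B; rewrite inE; apply/imsetP/andP => [[x x_i ->]|[B_in lt_i]].
  move: x_i; rewrite mem_block_row => /eqP <-.
  by rewrite setpart_pblock_mem block_rank_lt.
have /card_gt0P[x0 _] := leq_trans (ltn0Sn i) lt_i.
have [pE rE] := nth_block x0 B_in lt_i.
by exists (nth x0 (enum B) i); rewrite ?mem_block_row ?rE ?pE.
Qed.

Lemma count_setpart_shape (p : pred nat) :
  count p (setpart_shape A) = #|[set B in A | p #|B| ]|.
Proof.
rewrite count_sort count_map (@card_set_count _ _ _ (enum A)) ?enum_uniq //.
by move=> B; rewrite mem_enum.
Qed.

(** A pigeonhole argument: j + 1 entries of row k are sent injectively into row i, where at most j
    entries are smaller than the one in column j. *)
Lemma block_row_chain x0 i k j : i < k -> j < size (block_row k) ->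
  exists z w, [/\ pblock A z = pblock A w, nth x0 (block_row i) j <= z,
    z < w & w <= nth x0 (block_row k) j].
Proof.
move=> lt_ik lt_j.
set W := [set w | (w \in block_row k) && (w <= nth x0 (block_row k) j)].
have card_W : #|W| = j.+1.
  rewrite (@card_set_count _ _ _ (block_row k)) //.
    by rewrite increasing_count_leq // increasing_block_row.
  exact/increasing_uniq/increasing_block_row.
(* The element of rank i in the block of w exists because that block has an element of rank k > i,
   namely w. *)
pose f w := nth x0 (enum (pblock A w)) i.
have fP w : w \in W -> pblock A (f w) = pblock A w /\ block_rank A (f w) = i.
  rewrite inE mem_block_row => /andP[/eqP w_k _].
  apply: nth_block; first exact: setpart_pblock_mem.
  by rewrite (leq_trans lt_ik) // -w_k ltnW // block_rank_lt.
have card_fW : #|f @: W| = j.+1.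
  rewrite card_in_imset // => w v w_in v_in eq_f; apply: block_rank_inj.
    by have [<- _] := fP w w_in; rewrite eq_f; have [-> _] := fP v v_in.
  by move: w_in v_in; rewrite !inE !mem_block_row => /andP[/eqP-> _] /andP[/eqP->].
set Z := [set z | (z \in block_row i) && (z < nth x0 (block_row i) j)].
have card_Z : #|Z| <= j.
  rewrite (@card_set_count _ _ _ (block_row i)) //; last first.
    exact/increasing_uniq/increasing_block_row.
  (* If row i does not reach column j, [nth] returns [x0], and the length of row i still bounds
     [Z]. *)
  case: (ltnP j (size (block_row i))) => [lt_ji|le_ij].
    by rewrite increasing_count_ltn // increasing_block_row.
  exact: leq_trans (count_size _ _) le_ij.
have /subsetPn[z /imsetP[w w_in ->] fw_notin] : ~~ (f @: W \subset Z).
  by apply/negP=> /subset_leq_card; rewrite card_fW leqNgt ltnS card_Z.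
have [pE rE] := fP w w_in; exists (f w), w; split=> //.
- by move: fw_notin; rewrite inE mem_block_row rE eqxx /= -leqNgt.
(* Within a block rank is monotone, so w <= f w would give k <= i. *)
- rewrite ltnNge; apply/negP=> /(leq_block_rank (esym pE)).
  by move: w_in; rewrite inE mem_block_row rE => /andP[/eqP-> _]; rewrite leqNgt lt_ik.
- by move: w_in; rewrite inE => /andP[].
Qed.

(** * The tableau of a set partition whose shape is the conjugate of [mu] *)

Variable mu : seq nat.
Hypothesis mu_part : is_part_of n mu.
Hypothesis A_shape : setpart_shape A = conj_part mu.

Let mu_sorted : sorted geq mu. Proof. by case/and3P: mu_part. Qed.

Lemma size_block_row_part i : size (block_row i) = nth 0 mu i.
Proof.
by rewrite size_block_row -(count_setpart_shape (ltn i)) A_shape count_conj_part.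
Qed.

(** An index i is below either side exactly when row i is nonempty; for the right side this uses
    that the parts of [mu] are positive. *)
Lemma bigmax_block_part : \max_(B in A) #|B| = size mu.
Proof.
suff ltE i : (i < \max_(B in A) #|B|) = (i < size mu).
  apply/eqP; rewrite eqn_leq; apply/andP; split; rewrite leqNgt.
    by rewrite ltE ltnn.
  by rewrite -ltE ltnn.
have -> : (i < \max_(B in A) #|B|) = (0 < size (block_row i)).
  rewrite size_block_row; apply/idP/card_gt0P => [|[B]].
    move=> lt_i; have [B] : exists B, B \in [pred B in A | i < #|B|].
      apply/existsP; apply: contraLR lt_i; rewrite negb_exists -leqNgt => /forallP H.
      by apply/bigmax_leqP=> B B_in; have := H B; rewrite inE B_in /= -leqNgt.
    by rewrite inE => B_in; exists B; rewrite inE.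
  by rewrite inE => /andP[B_in /leq_trans]; apply; apply: leq_bigmax_cond.
rewrite size_block_row_part; case: (ltnP i (size mu)) => [lt_i|ge_i].
  rewrite lt0n; apply: contraL mu_part => /eqP nth0.
  by rewrite /is_part_of -nth0 mem_nth // andbF.
by rewrite nth_default.
Qed.

Lemma tableau_ofE : tableau_of A = [seq block_row i | i <- iota 0 (size mu)].
Proof. by rewrite /tableau_of bigmax_block_part. Qed.

Lemma nth_tableau_of i : nth [::] (tableau_of A) i = block_row i.
Proof.
rewrite tableau_ofE; case: (ltnP i (size mu)) => [lt_i|ge_i].
  by rewrite (nth_map 0) ?size_iota // nth_iota.
rewrite nth_default ?size_map ?size_iota //.
by apply/esym/size0nil; rewrite size_block_row_part nth_default.
Qed.

Lemma shape_tableau_of : [seq size r | r <- tableau_of A] = mu.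
Proof.
rewrite tableau_ofE -map_comp -[RHS](mkseq_nth 0).
by apply: eq_map => i /=; apply: size_block_row_part.
Qed.

(** Each x occurs in the row of its rank, and the rows have total length n, so nothing is
    repeated. *)
Lemma perm_flatten_tableau_of : perm_eq (flatten (tableau_of A)) (enum 'I_n).
Proof.
have sub x : x \in flatten (tableau_of A).
  apply/flattenP; exists (block_row (block_rank A x)); last by rewrite mem_block_row.
  apply/map_f; rewrite mem_iota /= add0n.
  exact: leq_trans (block_rank_lt x) (leq_bigmax_cond _ (setpart_pblock_mem x)).
rewrite perm_sym; apply: uniq_perm; first exact: enum_uniq.
  apply: (leq_size_uniq (enum_uniq 'I_n)) => //.
  rewrite size_enum_ord size_flatten /shape shape_tableau_of.
  by case/and3P: mu_part => _ _ /eqP->.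
by move=> x; rewrite mem_enum sub.
Qed.

(** The common core of the two column conditions: [r] will be the strict order, and then the
    relation of not both lying in a given block of the composition. *)
Lemma pairwise_column_tableau_of (r : rel 'I_n) j :
  (forall x y z w, pblock A z = pblock A w -> x <= z -> z < w -> w <= y -> r x y) ->
  pairwise r (column (tableau_of A) j).
Proof.
move=> rP; case c_eq: (column _ _) => [//|x0 c]; rewrite -c_eq.
have T_sorted : sorted geq [seq size s | s <- tableau_of A].
  by rewrite shape_tableau_of.
apply/(pairwiseP x0) => i k i_in k_in lt_ik.
rewrite !nth_column // !nth_tableau_of.
have [|z [w [eq_zw le_z lt_zw le_w]]] := @block_row_chain x0 i k j lt_ik; last first.
  exact: rP eq_zw le_z lt_zw le_w.
by rewrite size_block_row_part -ltn_count_gtn // -shape_tableau_of -size_column.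
Qed.

Lemma tableau_of_std : is_std_tableau mu (tableau_of A).
Proof.
rewrite /is_std_tableau shape_tableau_of eqxx perm_flatten_tableau_of /=.
apply/andP; split; apply/allP=> s /mapP[j _ ->].
  exact: increasing_block_row.
rewrite increasingE; apply: pairwise_column_tableau_of => x y z w _ xz zw wy.
exact: leq_trans (leq_ltn_trans xz zw) wy.
Qed.

Lemma tableau_of_SYT alpha :
  [forall B in A, forall C in comp_setpart n alpha, #|B :&: C| <= 1] ->
  tableau_of A \in SYT n mu alpha.
Proof.
move/forall_inP=> A_alpha; rewrite inE tableau_of_std /=.
apply/allP=> s /mapP[j _ ->]; apply/forall_inP => C C_in.
apply: count_le1_pairwise; apply: pairwise_column_tableau_of.
move=> x y z w eq_zw le_xz lt_zw le_wy; apply/negP=> /andP[x_C y_C].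
(* As [C] is an interval, it contains z and w along with x and y. *)
have C_mem (v : 'I_n) : x <= v -> v <= y -> v \in C.
  move: x_C y_C; case/imsetP: (C_in) => i _ ->.
  rewrite !inE => /andP[lo _] /andP[_ hi] xv vy.
  by rewrite (leq_trans lo xv) (leq_ltn_trans vy hi).
have /forall_inP/(_ C C_in)/card_le1_eqP H := A_alpha _ (setpart_pblock_mem w).
have z_w : z = w.
  apply: H; rewrite inE; apply/andP; split.
  - exact: setpart_mem_pblock.
  - exact: C_mem (leq_trans le_xz (ltnW lt_zw)) le_wy.
  - by rewrite -eq_zw setpart_mem_pblock.
  - exact: C_mem le_xz (leq_trans (ltnW lt_zw) le_wy).
by rewrite z_w ltnn in lt_zw.
Qed.

End SetPartitionTableau.

(** * The set partition formed by the columns of a standard tableau *)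

Section ColumnPartition.

Variables (n : nat) (mu : seq nat) (T : seq (seq 'I_n)).
Hypotheses (mu_part : is_part_of n mu) (T_std : is_std_tableau mu T).
Implicit Types (x : 'I_n) (i j : nat).

Let mu_sorted : sorted geq mu. Proof. by case/and3P: mu_part. Qed.
Let T_shape : [seq size r | r <- T] = mu. Proof. by case/and4P: T_std => /eqP. Qed.
Let T_uniq : uniq (flatten T).
Proof. by case/and4P: T_std => _ /perm_uniq-> _ _; apply: enum_uniq. Qed.

Definition column_block j : {set 'I_n} := [set x in column T j].

(** The first part of [mu] is the number of nonempty columns, so no index yields the empty set. *)
Definition column_setpart : {set {set 'I_n}} :=
  [set column_block j | j : 'I_(head 0 mu)].

Lemma size_head_std : size (head [::] T) = head 0 mu.
Proof. by rewrite -T_shape; case: (T). Qed.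

Lemma size_nth_std i : size (nth [::] T i) = nth 0 mu i.
Proof.
rewrite -T_shape; case: (ltnP i (size T)) => [lt_i|ge_i].
  by rewrite (nth_map [::]).
by rewrite !nth_default ?size_map.
Qed.

Lemma size_column_std j : size (column T j) = count (fun m => j < m) mu.
Proof. by rewrite size_column T_shape. Qed.

Lemma ltn_size_column_std i j : (i < size (column T j)) = (j < nth 0 mu i).
Proof. by rewrite size_column_std ltn_count_gtn. Qed.

Lemma nth_column_std x0 i j : i < size (column T j) ->
  nth x0 (column T j) i = nth x0 (nth [::] T i) j.
Proof. by apply: nth_column; rewrite T_shape. Qed.

Lemma size_column_gt0 j : (0 < size (column T j)) = (j < head 0 mu).
Proof. by rewrite ltn_size_column_std nth0. Qed.

Lemma increasing_column j : increasing (column T j).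
Proof.
case: (ltnP j (head 0 mu)) => [lt_j|].
  case/and4P: T_std => _ _ _ /allP; apply.
  by apply: map_f; rewrite mem_iota size_head_std.
(* Past the last column of [T], [column T j] is empty. *)
by rewrite leqNgt -size_column_gt0 lt0n negbK => /eqP/size0nil->.
Qed.

Lemma column_inj x j j' : x \in column T j -> x \in column T j' -> j = j'.
Proof.
move=> /(nthP x)[i lt_i <-] /(nthP x)[i' lt_i'].
rewrite !nth_column_std // => /(uniq_flatten_nth T_uniq).
rewrite !size_nth_std -!ltn_size_column_std.
by case/(_ lt_i' lt_i) => _ ->.
Qed.

Lemma column_entry x : exists i j,
  [/\ j < head 0 mu, i < size (column T j) & nth x (column T j) i = x].
Proof.
have /flattenP[r /(nthP [::])[i lt_i <-] /(nthP x)[j lt_j <-]] : x \in flatten T.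
  by case/and4P: T_std => _ /perm_mem-> _ _; rewrite mem_enum.
have lt_ic : i < size (column T j) by rewrite ltn_size_column_std -size_nth_std.
exists i, j; split=> //; first by rewrite -size_column_gt0 (leq_trans _ lt_ic).
by rewrite nth_column_std //; apply: set_nth_default.
Qed.

Lemma column_setpartP : is_setpart column_setpart.
Proof.
apply/and3P; split.
- rewrite eqEsubset subsetT; apply/subsetP => x _.
  have [i [j [lt_j lt_i <-]]] := column_entry x.
  apply/bigcupP; exists (column_block j); last by rewrite inE mem_nth.
  by apply/imsetP; exists (Ordinal lt_j).
- apply/trivIsetP => _ _ /imsetP[j _ ->] /imsetP[j' _ ->] neq_B.
  apply/pred0P => x; rewrite !inE; apply/negP=> /andP[x_j /(column_inj x_j) eq_j].
  by rewrite /column_block eq_j eqxx in neq_B.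
- apply/imsetP=> [[j _ /setP eq0]].
  have: 0 < size (column T j) by rewrite size_column_gt0.
  case c_eq: (column T j) => [//|x c] _.
  by have := eq0 x; rewrite !inE c_eq mem_head.
Qed.

Lemma card_column_block j : #|column_block j| = size (column T j).
Proof. by rewrite cardsE; apply/card_uniqP/increasing_uniq/increasing_column. Qed.

(** Both sides are sorted, so a permutation suffices. Distinct indices give distinct blocks, since
    columns are nonempty and disjoint; hence the image set keeps every column length with its
    multiplicity. *)
Lemma column_setpart_shape : setpart_shape column_setpart = conj_part mu.
Proof.
have geq_total : total geq by move=> a b; apply: leq_total.
have geq_trans : transitive geq by move=> a b c ab bc; apply: leq_trans bc ab.
have geq_anti : antisymmetric geq.
  by move=> a b; rewrite andbC => /anti_leq.
rewrite -[RHS](sorted_sort geq_trans (sorted_conj_part mu)).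
apply/perm_sortP => //.
have -> : conj_part mu =
    [seq #|B : {set 'I_n}| | B <- [seq column_block j | j <- iota 0 (head 0 mu)]].
  rewrite -map_comp; apply: eq_map => j /=.
  by rewrite card_column_block size_column_std.
apply/perm_map/uniq_perm; first exact: enum_uniq.
  rewrite map_inj_in_uniq ?iota_uniq // => j j'.
  rewrite !mem_iota !add0n /= => lt_j _ /setP eq_B.
  have: 0 < size (column T j) by rewrite size_column_gt0.
  case c_eq: (column T j) => [//|x c] _.
  have x_j : x \in column T j by rewrite c_eq mem_head.
  by apply: (column_inj x_j); have := eq_B x; rewrite !inE x_j.
move=> B; rewrite mem_enum; apply/imsetP/mapP => [[j _ ->]|[j]].
  by exists (j : nat); rewrite // mem_iota /=.
by rewrite mem_iota add0n /= => lt_j ->; exists (Ordinal lt_j).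
Qed.

(** The block of x is its column, which increases, so the elements below x in value are the i
    entries above it. *)
Lemma block_rank_column x i j : i < size (column T j) ->
  nth x (column T j) i = x -> block_rank column_setpart x = i.
Proof.
move=> lt_i x_eq.
have lt_j : j < head 0 mu by rewrite -size_column_gt0 (leq_trans _ lt_i).
have -> := block_rank_count (increasing_uniq (increasing_column j)).
  by rewrite -{1}x_eq increasing_count_ltn // increasing_column.
have -> : pblock column_setpart x = column_block j.
  apply: (setpart_def_pblock column_setpartP).
    by apply/imsetP; exists (Ordinal lt_j).
  by rewrite inE -x_eq mem_nth.
by move=> y; rewrite inE.
Qed.

(** Rows with the same index have the same elements, as rank in a column is row number; both being
    increasing, they coincide. *)
Lemma tableau_of_column_setpart : tableau_of column_setpart = T.
Proof.
have nth_tab := nth_tableau_of column_setpartP mu_part column_setpart_shape.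
have := shape_tableau_of column_setpartP mu_part column_setpart_shape.
rewrite -[RHS]T_shape => eq_shape.
have eq_size := congr1 size eq_shape; rewrite !size_map in eq_size.
apply: (@eq_from_nth _ [::]); first by rewrite size_map.
move=> i; rewrite size_map eq_size => lt_i; rewrite nth_tab.
apply: increasing_ext; first exact: increasing_block_row.
  by case/and4P: T_std => _ _ /allP + _; apply; apply: mem_nth.
move=> x; rewrite mem_block_row; apply/eqP/(nthP x) => [|[j lt_j]].
  have [k [j [_ lt_k x_eq]]] := column_entry x.
  rewrite (block_rank_column lt_k x_eq) => <-; exists j.
    by rewrite size_nth_std -ltn_size_column_std.
  by rewrite -nth_column_std.
have lt_ic : i < size (column T j) by rewrite ltn_size_column_std -size_nth_std.
by rewrite -nth_column_std //; apply: block_rank_column.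
Qed.

Lemma column_setpart_Pi alpha :
  T \in SYT n mu alpha -> column_setpart \in Pi_set n (conj_part mu) alpha.
Proof.
rewrite !inE => /andP[_ /allP T_alpha].
rewrite column_setpartP column_setpart_shape eqxx /=.
apply/forall_inP=> _ /imsetP[j _ ->]; apply/forall_inP=> C C_in.
have /T_alpha/forall_inP/(_ C C_in) : column T j \in columns T.
  by apply: map_f; rewrite mem_iota size_head_std /=.
(* Columns have no repeated entries, so the count along the column is the size of its intersection
   with [C]. *)
rewrite -(@card_set_count _ (mem (column_block j))).
- by apply: leq_trans; apply/subset_leq_card/subsetP => x; rewrite !inE.
- exact/increasing_uniq/increasing_column.
- by move=> x; rewrite inE.
Qed.

End ColumnPartition.

Theorem proposition2p2 (n : nat) (mu alpha : seq nat)
    (hmu : is_part_of n mu) (halpha : is_comp_of n alpha) :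
  (forall A : {set {set 'I_n}},
     A \in Pi_set n (conj_part mu) alpha -> tableau_of A \in SYT n mu alpha) /\
  (forall T : seq (seq 'I_n),
     T \in SYT n mu alpha ->
     exists2 A : {set {set 'I_n}},
       A \in Pi_set n (conj_part mu) alpha & tableau_of A = T).
Proof.
split=> [A|T T_SYT].
  by rewrite inE => /and3P[A_part /eqP A_shape]; apply: tableau_of_SYT.
have T_std : is_std_tableau mu T by case/andP: T_SYT.
exists (column_setpart mu T); first exact: column_setpart_Pi.
exact: tableau_of_column_setpart.
Qed.
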